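(* Let $f\in\mathcal{F}_{\mu,L}$ with $0<\mu\le L$ and minimizer $x^*$. Let $\kappa=L/\mu$, $\rho=1-\sqrt{1/\kappa}$, $\alpha=\frac{1+\rho}{L}$, $\beta=\frac{\rho^2}{2-\rho}$, $\gamma=\frac{\rho^2}{(1+\rho)(2-\rho)}$, $M=\Big(\frac{1-\beta}{\sqrt{\alpha}(1+\beta)}\Big)^2$ and $\xi=2/3$. With the choice $$q=\xi\sqrt{M},\quad m=\gamma\sqrt{\alpha}\,(1+\sqrt{M\alpha}),\quad n=(2-\xi)\sqrt{M},\quad p=\frac{(1-\xi\gamma\sqrt{M\alpha})(1+\sqrt{M\alpha})}{(2-\xi)\sqrt{M}},$$ the system $$\dot{Y}_t=-m\nabla f(Y_t)-n(Y_t-V_t),\qquad \dot{V}_t=-p\nabla f(Y_t)-q(V_t-Y_t),\qquad t\ge 0,$$ reduces to the ODE $$\ddot{Y}_t+2\sqrt{M}\,\dot{Y}_t+\gamma(1+\sqrt{M\alpha})\sqrt{\alpha}\,\nabla^2 f(Y_t)\dot{Y}_t+(1+\sqrt{M\alpha})\nabla f(Y_t)=0 .$$ Furthermore, its trajectories satisfy $$f(Y_t)-f(x^* )\le C_{TM}\,e^{-(2-\xi)\sqrt{M}\,t},\qquad t\ge 0,$$ where $C_{TM}$ is a positive constant.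
   Context: $\mathcal{F}_{\mu,L}$ is the class of functions $f:\mathbb{R}^d\to\mathbb{R}$ that are $\mu$-strongly convex and $L$-smooth (the gradient is $L$-Lipschitz). Dots denote time derivatives; when the Hessian appears, $f$ is understood to be twice continuously differentiable. ''Reduces to'' means that eliminating $V_t$ from the first-order system yields the displayed second-order ODE for $Y_t$. The parameters $\alpha,\beta,\gamma$ are those of the triple momentum method. The constant $C_{TM}$ does not depend on $t$ (it may depend on the initial data and the parameters). *)

(* Defs.v *)
From mathcomp Require Import all_boot all_order all_algebra.
From mathcomp Require Import all_classical all_reals all_analysis.

Set Implicit Arguments.
Unset Strict Implicit.
Unset Printing Implicit Defensive.

Import Order.TTheory GRing.Theory Num.Theory.
Import numFieldNormedType.Exports.

Local Open Scope classical_set_scope.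
Local Open Scope ring_scope.

(* R^d is the type of row vectors.  The library norm on 'rV[R]_d is the sup
   norm: it is used only for the topology and for differentiability, which do
   not depend on the choice of a norm.  Strong convexity and smoothness, whose
   constants do depend on it, are stated with the Euclidean norm below. *)
Definition dotv (R : realType) (d : nat) (x y : 'rV[R]_d) : R :=
  \sum_(i < d) x ord0 i * y ord0 i.

Definition enorm (R : realType) (d : nat) (x : 'rV[R]_d) : R :=
  Num.sqrt (dotv x x).

Definition grad (R : realType) (d : nat) (f : 'rV[R]_d -> R) (x : 'rV[R]_d)
  : 'rV[R]_d :=
  \row_(i < d) 'D_(delta_mx ord0 i) f x.

(* The library's Jacobian acts on row vectors from the right, so the
   Hessian-vector product is [v *m hess f x]. *)
Definition hess (R : realType) (d : nat) (f : 'rV[R]_d -> R) (x : 'rV[R]_d)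
  : 'M[R]_d :=
  jacobian (grad f) x.

Definition twice_cont_diff (R : realType) (d : nat) (f : 'rV[R]_d -> R)
  : Prop :=
  [/\ forall x, differentiable f x,
      forall x, differentiable (grad f) x
    & continuous (hess f)].

Definition strongly_convex (R : realType) (d : nat) (mu : R)
  (f : 'rV[R]_d -> R) : Prop :=
  forall (x y : 'rV[R]_d) (t : R), 0 <= t -> t <= 1 ->
    f (t *: x + (1 - t) *: y) <=
      t * f x + (1 - t) * f y - mu / 2 * t * (1 - t) * enorm (x - y) ^+ 2.

Definition smooth (R : realType) (d : nat) (L : R) (f : 'rV[R]_d -> R)
  : Prop :=
  (forall x, differentiable f x) /\
  (forall x y, enorm (grad f x - grad f y) <= L * enorm (x - y)).

Definition class_F (R : realType) (d : nat) (mu L : R) (f : 'rV[R]_d -> R)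
  : Prop :=
  strongly_convex mu f /\ smooth L f.

(* [Y] has derivative [v] at [t] along [0, +oo[: the ordinary derivative when
   0 < t, the right derivative when t = 0.  Values of [Y] at negative times are
   irrelevant when 0 <= t. *)
Definition has_derive_ge0 (R : realType) (d : nat) (Y : R -> 'rV[R]_d) (t : R)
  (v : 'rV[R]_d) : Prop :=
  (fun s => (s - t)^-1 *: (Y s - Y t)) @ within [set s | 0 <= s] (t^') --> v.

Definition system_trajectory (R : realType) (d : nat) (f : 'rV[R]_d -> R)
  (m n p q : R) (Y V : R -> 'rV[R]_d) : Prop :=
  forall t : R, 0 <= t ->
    has_derive_ge0 Y t (- (m *: grad f (Y t)) - n *: (Y t - V t)) /\
    has_derive_ge0 V t (- (p *: grad f (Y t)) - q *: (V t - Y t)).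

(* Y'' + a Y' + b (Hessian f)(Y) Y' + c grad f (Y) = 0 on [0, +oo[ *)
Definition ode_solution (R : realType) (d : nat) (f : 'rV[R]_d -> R)
  (a b c : R) (Y : R -> 'rV[R]_d) : Prop :=
  exists Y' Y'' : R -> 'rV[R]_d,
    forall t : R, 0 <= t ->
      [/\ has_derive_ge0 Y t (Y' t),
          has_derive_ge0 Y' t (Y'' t)
        & Y'' t + a *: Y' t + b *: (Y' t *m hess f (Y t))
            + c *: grad f (Y t) = 0].

(* Main.v *)
Require Import Defs.
From mathcomp Require Import all_boot all_order all_algebra.
From mathcomp Require Import all_classical all_reals all_analysis.
From mathcomp Require Import ring lra.

(** Reduction to the ODE.  Differentiating the first equation and replacing
    [V'] by the second one, then [n (V - Y)] by [Y' + m grad f (Y)], leaves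
    [Y'' + (n + q) Y' + m Hess f (Y) Y' + (n p + q m) grad f (Y) = 0].
    Conversely, as [n] is nonzero, [V = Y + (Y' + m grad f (Y)) / n] recovers
    the second unknown from a solution of the ODE ([system_iff_ode]).

    Decay.  Here [xi = 2/3], so that [q = n / 2].  Write [y = Y - xstar],
    [v = V - xstar], [g = grad f (Y)] and [a = n / p].  The energy
      [E = f (Y) - f xstar + (a / 2) |v|^2 - (a / 4) |y|^2]
    is chosen so that in [E' + n E] all the products of [v] with [g], [y] and
    [v] cancel.  What remains is [n (f (Y) - f xstar - <g, y>)] plus terms in
    [|g|^2], [<g, y>] and [|y|^2], and strong convexity bounds it by
      [m (a / 2 - mu) <g, y> + (n / 2) (a / 2 - mu) |y|^2],
    which is nonpositive as soon as [a <= 2 mu] ([energy_rate_le]).  So [E]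
    decays like [e^(- n t)].

    The energy contains a negative multiple of [|y|^2], hence does not bound
    [f (Y) - f xstar] by itself.  But quadratic growth of [f] at its minimizer
    gives [f (Y) - f xstar >= (mu / 2) |y|^2 >= (a / 4) |y|^2], so [E] bounds
    [|v|^2]; the first equation is a damped equation for [y] forced by [v],
    with a damping fast enough for [|y|^2] to inherit the rate [n]; and then
    [f (Y) - f xstar <= E + (a / 4) |y|^2] decays at the rate [n] too
    ([system_value_decay]).

    For the parameters of the triple momentum method, [a <= 2 mu] becomes a
    polynomial inequality in [rho], strict for [0 <= rho < 1], where
    [a / (2 mu)] tends to [1] as [rho] tends to [1]
    ([triple_momentum_coupling_bound]). *)

Import Order.TTheory GRing.Theory Num.Theory.
Import numFieldNormedType.Exports.

Local Open Scope classical_set_scope.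
Local Open Scope ring_scope.

(** * One-sided derivatives as ordinary derivatives of extensions *)

Lemma is_derive_slopeP {R : realType} (W : normedModType R) (Z : R -> W)
    (t : R) (v : W) :
  (fun s => (s - t)^-1 *: (Z s - Z t)) @ t^' --> v <-> is_derive t 1 Z v.
Proof.
have slopeE : (fun h : R => h^-1 *: ((Z \o shift t) (h *: (1 : R)) - Z t)) =
    (fun s => (s - t)^-1 *: (Z s - Z t)) \o shift t.
  by apply/funext => h /=; rewrite [h *: _]mulr1 addrK.
have shiftE : shift t @ (0 : R)^' = t^'.
  apply/funext => A.
  transitivity (\forall h \near (0 : R), h != 0 -> A (h + t)); first by [].
  transitivity (\forall s \near t, s != t -> A s); last by [].
  rewrite [in RHS](near_shift (0 : R) t) subr0; congr (nbhs _ _).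
  by apply/funext => h /=; rewrite -(subr_eq0 (h + t)) addrK.
split=> [slope|[dZ <-]].
  have dZ : (fun h : R => h^-1 *: ((Z \o shift t) (h *: (1 : R)) - Z t)) @ 0^'
      --> v.
    by rewrite slopeE fmap_comp shiftE.
  by apply: DeriveDef; [apply/cvg_ex; exists v|exact: cvg_lim dZ].
by move: dZ; rewrite /derivable /derive slopeE fmap_comp shiftE.
Qed.

(** Continuing a curve affinely to negative times, with its right derivative at
    [0] as slope, turns one-sided derivatives into two-sided ones, so that the
    usual rules of differentiation apply. *)
Lemma has_derive_ge0_extension {R : realType} {d : nat} (Y v : R -> 'rV[R]_d) :
  (forall t : R, 0 <= t -> has_derive_ge0 Y t (v t)) ->
  exists Z : R -> 'rV[R]_d, (forall t : R, 0 <= t -> Z t = Y t) /\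
    (forall t : R, 0 <= t -> is_derive t 1 Z (v t)).
Proof.
move=> dY.
exists (fun s => if 0 <= s then Y s else Y 0 + s *: v 0); split=> [t ->//|t t0].
apply/is_derive_slopeP/cvgrPdist_le => e e0; rewrite t0.
have /cvgrPdist_le/(_ _ e0) := dY _ t0; rewrite near_withinE => dYe.
(* The affine piece is met near [t] only if [t = 0], and there its slope is
   exactly [v 0]. *)
have neg : \forall s \near t^', ~~ (0 <= s) -> t = 0.
  move: t0; rewrite le_eqVlt => /predU1P[<-|t0]; first by near=> s.
  apply: nbhs_dnbhs; near=> s; rewrite -ltNge => s0.
  have : 0 < s by near: s; exact: lt_nbhsr.
  by rewrite ltNge (ltW s0).
near=> s; have [s0|s0] := boolP (0 <= s); first exact: (near dYe s).
have tE : t = 0 by exact: (near neg s).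
rewrite tE subr0 (addrC (Y 0)) addrK scalerA mulVf; last first.
  by apply: contraNneq s0 => ->.
by rewrite scale1r subrr normr0 ltW.
Unshelve. all: by end_near. Qed.

(** The way back from an extension to the curve itself. *)
Lemma is_derive_has_derive_ge0 {R : realType} {d : nat} (Z Y : R -> 'rV[R]_d)
    (t : R) (v : 'rV[R]_d) :
  0 <= t -> (forall s : R, 0 <= s -> Z s = Y s) -> is_derive t 1 Z v ->
  has_derive_ge0 Y t v.
Proof.
move=> t0 ZY /is_derive_slopeP/cvgrPdist_le slope.
apply/cvgrPdist_le => e e0; rewrite near_withinE.
by apply: filterS (slope _ e0) => s /= + s0; rewrite !ZY.
Qed.

(** * Euclidean inner product and derivatives along curves *)

Lemma dotvC {R : realType} {d : nat} (x y : 'rV[R]_d) : dotv x y = dotv y x.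
Proof. by apply: eq_bigr => i _; rewrite mulrC. Qed.

Lemma dotvDl {R : realType} {d : nat} (x y z : 'rV[R]_d) :
  dotv (x + y) z = dotv x z + dotv y z.
Proof.
by rewrite -big_split; apply: eq_bigr => i _; rewrite mxE mulrDl.
Qed.

Lemma dotvZl {R : realType} {d : nat} (a : R) (x y : 'rV[R]_d) :
  dotv (a *: x) y = a * dotv x y.
Proof. by rewrite mulr_sumr; apply: eq_bigr => i _; rewrite mxE mulrA. Qed.

Lemma dotvNl {R : realType} {d : nat} (x y : 'rV[R]_d) :
  dotv (- x) y = - dotv x y.
Proof. by rewrite -scaleN1r dotvZl mulN1r. Qed.

Lemma dotvDr {R : realType} {d : nat} (x y z : 'rV[R]_d) :
  dotv x (y + z) = dotv x y + dotv x z.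
Proof. by rewrite dotvC dotvDl !(dotvC x). Qed.

Lemma dotvZr {R : realType} {d : nat} (a : R) (x y : 'rV[R]_d) :
  dotv x (a *: y) = a * dotv x y.
Proof. by rewrite dotvC dotvZl (dotvC x). Qed.

Lemma dotvNr {R : realType} {d : nat} (x y : 'rV[R]_d) :
  dotv x (- y) = - dotv x y.
Proof. by rewrite dotvC dotvNl (dotvC x). Qed.

Definition dotvE {R : realType} {d : nat} :=
  (@dotvDl R d, @dotvDr R d, @dotvNl R d, @dotvNr R d,
   @dotvZl R d, @dotvZr R d).

Lemma dotv_ge0 {R : realType} {d : nat} (x : 'rV[R]_d) : 0 <= dotv x x.
Proof. by apply: sumr_ge0 => i _; rewrite -expr2 sqr_ge0. Qed.

Lemma enorm_sqr {R : realType} {d : nat} (x : 'rV[R]_d) :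
  enorm x ^+ 2 = dotv x x.
Proof. by rewrite sqr_sqrtr// dotv_ge0. Qed.

Lemma derive_grad {R : realType} {d : nat} (f : 'rV[R]_d -> R)
    (x v : 'rV[R]_d) :
  differentiable f x -> 'D_v f x = dotv (grad f x) v.
Proof.
move=> df; rewrite deriveE// [in LHS](row_sum_delta v) linear_sum.
by apply: eq_bigr => i _; rewrite linearZ/= mxE deriveE// mulrC.
Qed.

Lemma is_derive_comp_diff {R : realType} (V W : normedModType R) (F : V -> W)
    (Z : R -> V) (t : R) (v : V) :
  differentiable F (Z t) -> is_derive t 1 Z v ->
  is_derive t 1 (F \o Z) ('D_v F (Z t)).
Proof.
move=> dF [/derivable1_diffP dZ Zv].
have dFZ : differentiable (F \o Z) t by exact: differentiable_comp.
apply: DeriveDef; first exact/derivable1_diffP.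
by rewrite !deriveE// diff_comp//= -Zv deriveE.
Qed.

Lemma is_derive_dotv {R : realType} {d : nat} {X Z : R -> 'rV[R]_d} {t : R}
    {x z : 'rV[R]_d} :
  is_derive t 1 X x -> is_derive t 1 Z z ->
  is_derive t 1 (fun s => dotv (X s) (Z s)) (dotv x (Z t) + dotv (X t) z).
Proof.
have coord (U : R -> 'rV[R]_d) u i :
    is_derive t 1 U u -> is_derive t 1 (fun s => U s ord0 i) (u ord0 i).
  move=> [dU <-]; apply: DeriveDef; first by move/derivable_mxP: dU; exact.
  by rewrite derive_mx// mxE.
move=> dX dZ.
have -> : (fun s => dotv (X s) (Z s)) =
    \sum_(i < d) ((fun s => X s ord0 i) * (fun s => Z s ord0 i)).
  by apply/funext => s; rewrite fct_sumE.
have dXZ := is_derive_sum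
  (fun i => is_deriveM (coord _ _ i dX) (coord _ _ i dZ)).
apply: is_derive_eq dXZ _.
rewrite big_split addrC; congr (_ + _).
by apply: eq_bigr => i _; rewrite [LHS]mulrC.
Qed.

(** * Consequences of strong convexity *)

(** Divide the convexity inequality on the segment from [x] to [y] by its
    parameter and let that parameter tend to [0]. *)
Lemma strongly_convex_gradient {R : realType} {d : nat} (mu : R)
    (f : 'rV[R]_d -> R) (x y : 'rV[R]_d) :
  0 <= mu -> strongly_convex mu f -> differentiable f x ->
  f x - f y + mu / 2 * dotv (x - y) (x - y) <= dotv (grad f x) (x - y).
Proof.
move=> mu0 cvx df; rewrite -(opprB y x) !dotvNr dotvNl opprK -derive_grad//.
set N := dotv _ _; rewrite lerNr opprD opprB.
have N0 : 0 <= mu / 2 * N by rewrite mulr_ge0 ?divr_ge0 ?dotv_ge0.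
apply/ler_addgt0Pr => e e0.
have dfv : derivable f x (y - x) by exact: diff_derivable.
have slope := cvg_dnbhs_at_right dfv.
apply: (cvgr_to_le slope); near=> h.
have h0 : 0 < h by near: h; exact: nbhs_right_gt.
have h1 : h <= 1 by near: h; apply: nbhs_right_le.
have he : h * (mu / 2 * N + 1) <= e.
  rewrite -ler_pdivlMr; last lra.
  by near: h; apply: nbhs_right_le; rewrite divr_gt0//; lra.
have := cvx y x h (ltW h0) h1; rewrite enorm_sqr -/N.
have -> : h *: y + (1 - h) *: x = h *: (y - x) + x.
  by rewrite scalerBr scalerBl scale1r addrA addrAC.
move=> cvxh; rewrite [leLHS]mulrC ler_pdivrMr//=.
have : h * (mu / 2 * N + 1) * h <= e * h by rewrite ler_pM2r.
have : 0 <= h * h by rewrite mulr_ge0// ltW.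
by lra.
Unshelve. all: by end_near. Qed.

(** Bounding [f] below by its minimum at the point [h y + (1 - h) xstar] of the
    segment gives the inequality with the extra factor [1 - h]. *)
Lemma strongly_convex_growth {R : realType} {d : nat} (mu : R)
    (f : 'rV[R]_d -> R) (xstar y : 'rV[R]_d) :
  0 <= mu -> strongly_convex mu f -> (forall x, f xstar <= f x) ->
  mu / 2 * dotv (y - xstar) (y - xstar) <= f y - f xstar.
Proof.
move=> mu0 cvx min; set N := dotv _ _.
have N0 : 0 <= mu / 2 * N by rewrite mulr_ge0 ?divr_ge0 ?dotv_ge0.
have chord h : 0 < h -> h <= 1 -> mu / 2 * N * (1 - h) <= f y - f xstar.
  move=> h0 h1; rewrite -(ler_pM2l h0).
  have := cvx y xstar h (ltW h0) h1; rewrite enorm_sqr -/N.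
  by have := min (h *: y + (1 - h) *: xstar); lra.
rewrite leNgt; apply/negP => lt.
have b0 : 0 < mu / 2 * N by apply: le_lt_trans lt; rewrite subr_ge0.
(* This [h] makes [chord] fail: half of the assumed gap is lost in [1 - h]. *)
pose h := (mu / 2 * N - (f y - f xstar)) / (mu / 2 * N) / 2.
have hE : mu / 2 * N * h = (mu / 2 * N - (f y - f xstar)) / 2.
  by rewrite /h mulrA mulrCA divff ?mulr1// gt_eqF.
have h0 : 0 < h by rewrite /h !divr_gt0// subr_gt0.
have h1 : h <= 1.
  by rewrite -(ler_pM2l b0) hE; have := min y; lra.
by have := chord h h0 h1; rewrite mulrBr hE; lra.
Qed.

(** * Differential inequalities *)

Lemma nonincreasing_of_derive_le0 {R : realType} (phi dphi : R -> R) (t : R) :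
  (forall s : R, 0 <= s -> is_derive s 1 phi (dphi s)) ->
  (forall s : R, 0 <= s -> dphi s <= 0) -> 0 <= t -> phi t <= phi 0.
Proof.
move=> dP le0 t0; have in0 s : s \in `]0, +oo[%R -> 0 <= s.
  by rewrite in_itv/= andbT => /ltW.
apply: (@ler0_derive1_nincry _ phi 0) => // [s /in0/dP[]//|s /in0 s0|].
  by rewrite derive1E; case: (dP _ s0) => _ ->; exact: le0.
apply: derivable_within_continuous => s; rewrite in_itv/= andbT.
by case/dP.
Qed.

Lemma is_derive_expR_linear {R : realType} (r s : R) :
  is_derive s 1 (fun u => expR (r * u)) (r * expR (r * s)).
Proof.
have dlin : is_derive s 1 (fun u : R => r * u) r.
  have := is_deriveZ r (is_derive_id (s : R^o) (1 : R^o)).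
  by rewrite [_ *: _]mulr1.
rewrite mulrC.
exact: (is_derive1_comp (f := expR) (g := fun u : R => r * u)).
Qed.

(** The hypothesis says that [e^(r t) E(t)] has a nonpositive derivative. *)
Lemma exponential_decay {R : realType} (r : R) (E dE : R -> R) (t : R) :
  (forall s : R, 0 <= s -> is_derive s 1 E (dE s)) ->
  (forall s : R, 0 <= s -> dE s <= - r * E s) -> 0 <= t ->
  E t <= E 0 * expR (- (r * t)).
Proof.
move=> dEs leE t0; rewrite expRN ler_pdivlMr ?expR_gt0//.
pose phi : R -> R := E * (fun s => expR (r * s)).
suff : phi t <= phi 0 by rewrite /phi !fctE mulr0 expR0 mulr1.
apply: (@nonincreasing_of_derive_le0 _ phi
   (fun s => (dE s + r * E s) * expR (r * s))) => // s s0.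
  apply: is_derive_eq (is_deriveM (dEs _ s0) (is_derive_expR_linear r s)) _.
  by rewrite /GRing.scale /=; ring.
by rewrite pmulr_lle0 ?expR_gt0//; have := leE _ s0; lra.
Qed.

(** * Elimination of the second unknown *)

Lemma system_iff_ode {R : realType} {d : nat} (f : 'rV[R]_d -> R) (m n p q : R)
    (Y : R -> 'rV[R]_d) :
  n != 0 -> (forall x, differentiable (grad f) x) ->
  (exists V : R -> 'rV[R]_d, system_trajectory f m n p q Y V) <->
  ode_solution f (n + q) m (n * p + q * m) Y.
Proof.
move=> n0 df.
have dgrad (Z : R -> 'rV[R]_d) (t : R) (v : 'rV[R]_d) : is_derive t 1 Z v ->
    is_derive t 1 (grad f \o Z) (v *m hess f (Z t)).
  move=> dZ.
  have -> : v *m hess f (Z t) = 'D_v (grad f) (Z t) by rewrite deriveEjacobian.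
  exact: is_derive_comp_diff (df _) dZ.
split=> [[V sys]|[Y' [Y'' ode]]].
- have [Z [ZY dZ]] := has_derive_ge0_extension Y _ (fun t t0 => (sys t t0).1).
  have [U [UV dU]] := has_derive_ge0_extension V _ (fun t t0 => (sys t t0).2).
  pose Y' t := - (m *: grad f (Y t)) - n *: (Y t - V t).
  pose V' t := - (p *: grad f (Y t)) - q *: (V t - Y t).
  exists Y', (fun t => - (m *: (Y' t *m hess f (Y t))) - n *: (Y' t - V' t)).
  move=> t t0; split; first exact: (sys t t0).1.
    have dG := dgrad Z t _ (dZ t t0); rewrite [in hess _ _]ZY// in dG.
    pose G s := - (m *: grad f (Z s)) - n *: (Z s - U s).
    apply: (is_derive_has_derive_ge0 G _ _ _ t0) => [s s0|].
      by rewrite /G ZY// UV.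
    exact: is_deriveB (is_deriveN (is_deriveZ m dG))
      (is_deriveZ n (is_deriveB (dZ t t0) (dU t t0))).
  move: (Y' t *m _) => H; rewrite /Y' /V'; move: (grad f (Y t)) => g.
  by apply/rowP => i; rewrite !mxE; ring.
- have [Z [ZY dZ]] : exists Z : R -> 'rV[R]_d,
      (forall t : R, 0 <= t -> Z t = Y t) /\
      (forall t : R, 0 <= t -> is_derive t 1 Z (Y' t)).
    by apply: has_derive_ge0_extension => t /ode[].
  have [U [UY' dU]] : exists U : R -> 'rV[R]_d,
      (forall t : R, 0 <= t -> U t = Y' t) /\
      (forall t : R, 0 <= t -> is_derive t 1 U (Y'' t)).
    by apply: has_derive_ge0_extension => t /ode[].
  pose V t := Y t + n^-1 *: (Y' t + m *: grad f (Y t)).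
  exists V => t t0; have [dY _ eqY] := ode t t0; split.
    have -> : - (m *: grad f (Y t)) - n *: (Y t - V t) = Y' t; last by [].
    rewrite /V opprD addrA subrr sub0r scalerN opprK scalerA divff// scale1r.
    by rewrite addrC addrK.
  have dG := dgrad Z t _ (dZ t t0); rewrite [in hess _ _]ZY// in dG.
  pose G s := Z s + n^-1 *: (U s + m *: grad f (Z s)).
  apply: (is_derive_has_derive_ge0 G _ _ _ t0) => [s s0|].
    by rewrite /G ZY// UY'.
  have dV := is_deriveD (dZ t t0)
    (is_deriveZ n^-1 (is_deriveD (dU t t0) (is_deriveZ m dG))).
  apply: is_derive_eq dV _; rewrite /V.
  move: (Y' t *m _) (grad f (Y t)) eqY => H g eqY.
  apply/rowP => i; have := congr1 (fun r : 'rV_d => r 0 i) eqY.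
  rewrite !mxE => eqi; apply: (mulfI n0); apply/eqP.
  by rewrite -subr_eq0 -[X in _ == X]eqi; apply/eqP; field.
Qed.

(** * Lyapunov analysis of the system *)

(** The pointwise form of [E' + n E <= 0], in which [F] stands for
    [f (Y) - f xstar].  The term [m <g, y>] is absorbed by [- m |g|^2] thanks to
    [mu <g, y> <= |g|^2]; this follows from [|g - mu y|^2 >= 0] and
    [mu |y|^2 <= <g, y>]. *)
Lemma energy_rate_le {R : realType} {d : nat} (mu m n p F : R)
    (g y v y' v' : 'rV[R]_d) :
  0 < mu -> 0 <= m -> 0 < n -> 0 < p -> n / p <= 2 * mu ->
  mu / 2 * dotv y y <= F -> F + mu / 2 * dotv y y <= dotv g y ->
  y' = - (m *: g) - n *: (y - v) -> v' = - (p *: g) - (n / 2) *: (v - y) ->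
  dotv g y' + n / p / 2 * (dotv v' v + dotv v v') -
    n / p / 4 * (dotv y' y + dotv y y') <=
  - n * (F + n / p / 2 * dotv v v - n / p / 4 * dotv y y).
Proof.
move=> mu0 m0 n0 p0; set a := n / p => amu grow grd -> ->.
have apE : a * p = n by rewrite /a divfK ?gt_eqF.
have := dotv_ge0 (g - mu *: y); have := dotv_ge0 y.
rewrite !dotvE (dotvC v y) (dotvC y g) (dotvC v g).
move: (dotv g g) (dotv g y) (dotv g v) (dotv y y) (dotv y v) (dotv v v)
  grow grd => gg gy gv yy yv vv grow grd yy0 sq0.
have gyyy : mu * yy <= gy by lra.
have ggy : mu * gy <= gg.
  have : mu * (mu * yy) <= mu * gy by rewrite ler_pM2l.
  by lra.
have gy0 : 0 <= gy by apply: le_trans gyyy; rewrite mulr_ge0// ltW.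
rewrite -subr_ge0.
set diff := (X in 0 <= X).
have -> : diff = n * (gy - (F + mu / 2 * yy)) + m * (gg - mu * gy)
    + (2 * mu - a) * (m * gy) / 2 + (2 * mu - a) * (n * yy) / 4.
  by rewrite /diff -apE; field.
rewrite !addr_ge0// ?divr_ge0// ?mulr_ge0// ?subr_ge0// ?mulr_ge0//; exact: ltW.
Qed.

Lemma system_energy_decay {R : realType} {d : nat} (mu m n p : R)
    (f : 'rV[R]_d -> R) (xstar : 'rV[R]_d) (Y V : R -> 'rV[R]_d) (t : R) :
  0 < mu -> 0 <= m -> 0 < n -> 0 < p -> n / p <= 2 * mu ->
  strongly_convex mu f -> (forall x, differentiable f x) ->
  (forall x, f xstar <= f x) ->
  let E s := f (Y s) - f xstar +
    n / p / 2 * dotv (V s - xstar) (V s - xstar) -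
    n / p / 4 * dotv (Y s - xstar) (Y s - xstar) in
  (forall s : R, 0 <= s ->
    is_derive s 1 Y (- (m *: grad f (Y s)) - n *: (Y s - V s))) ->
  (forall s : R, 0 <= s ->
    is_derive s 1 V (- (p *: grad f (Y s)) - (n / 2) *: (V s - Y s))) ->
  0 <= t -> E t <= E 0 * expR (- (n * t)).
Proof.
move=> mu0 m0 n0 p0; set a := n / p => amu cvx df min E dY dV t0.
have apE : a * p = n by rewrite /a divfK ?gt_eqF.
pose y s := Y s - xstar; pose v s := V s - xstar.
pose Y' s := - (m *: grad f (Y s)) - n *: (Y s - V s).
pose V' s := - (p *: grad f (Y s)) - (n / 2) *: (V s - Y s).
pose E' s := dotv (grad f (Y s)) (Y' s) +
  a / 2 * (dotv (V' s) (v s) + dotv (v s) (V' s)) -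
  a / 4 * (dotv (Y' s) (y s) + dotv (y s) (Y' s)).
apply: (@exponential_decay _ n E E') => // s s0.
  have dy : is_derive s 1 y (Y' s).
    have := is_deriveB (dY s s0) (is_derive_cst xstar s 1).
    by rewrite subr0.
  have dv : is_derive s 1 v (V' s).
    have := is_deriveB (dV s s0) (is_derive_cst xstar s 1).
    by rewrite subr0.
  have dfY : is_derive s 1 (f \o Y) (dotv (grad f (Y s)) (Y' s)).
    by rewrite -derive_grad//; apply: is_derive_comp_diff => //; exact: dY.
  have dE := is_deriveB (is_deriveD
     (is_deriveB dfY (is_derive_cst (f xstar) s 1))
     (is_deriveZ (a / 2) (is_derive_dotv dv dv)))
     (is_deriveZ (a / 4) (is_derive_dotv dy dy)).
  by apply: is_derive_eq dE _; rewrite subr0.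
apply: (energy_rate_le mu m n p) => //; last first.
- by rewrite /V' /y /v opprB addrA subrK.
- by rewrite /Y' /y /v opprB addrA subrK.
- exact: strongly_convex_gradient (ltW mu0) cvx (df _).
- exact: strongly_convex_growth (ltW mu0) cvx min.
Qed.

(** Since [a |v|^2 / 2 <= E], Young's inequality
    [2 <y, v> <= |y|^2 / 2 + 2 |v|^2] in the first equation gives
    [(|y|^2)' <= - (3 n / 2) |y|^2 + (4 n E0 / a) e^(- n t)].  Splitting the
    inner product in this way keeps a damping [3 n / 2] above the forcing rate
    [n]: with equal rates a factor [t] would appear. *)
Lemma system_value_decay {R : realType} {d : nat} (mu m n p : R)
    (f : 'rV[R]_d -> R) (xstar : 'rV[R]_d) (Y V : R -> 'rV[R]_d) (t : R) :
  0 < mu -> 0 <= m -> 0 < n -> 0 < p -> n / p <= 2 * mu ->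
  strongly_convex mu f -> (forall x, differentiable f x) ->
  (forall x, f xstar <= f x) ->
  (forall s : R, 0 <= s ->
    is_derive s 1 Y (- (m *: grad f (Y s)) - n *: (Y s - V s))) ->
  (forall s : R, 0 <= s ->
    is_derive s 1 V (- (p *: grad f (Y s)) - (n / 2) *: (V s - Y s))) ->
  0 <= t ->
  let E0 := f (Y 0) - f xstar +
    n / p / 2 * dotv (V 0 - xstar) (V 0 - xstar) -
    n / p / 4 * dotv (Y 0 - xstar) (Y 0 - xstar) in
  0 <= E0 /\
  f (Y t) - f xstar <=
    (3 * E0 + n / p / 4 * dotv (Y 0 - xstar) (Y 0 - xstar)) * expR (- (n * t)).
Proof.
move=> mu0 m0 n0 p0 amu cvx df min dY dV t0 E0.
pose a := n / p; have a0 : 0 < a by rewrite divr_gt0.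
pose y s := Y s - xstar; pose v s := V s - xstar.
pose E s := f (Y s) - f xstar + a / 2 * dotv (v s) (v s) -
  a / 4 * dotv (y s) (y s).
have decay (s : R) : 0 <= s -> E s <= E0 * expR (- (n * s)).
  exact: system_energy_decay mu0 m0 n0 p0 amu cvx df min dY dV.
have coercive s : a / 2 * dotv (v s) (v s) <= E s.
  have := strongly_convex_growth mu f xstar (Y s) (ltW mu0) cvx min.
  have : a / 4 * dotv (y s) (y s) <= mu / 2 * dotv (y s) (y s).
    by rewrite ler_wpM2r ?dotv_ge0//; rewrite -/a in amu; lra.
  by rewrite /E -/(y s); lra.
have E00 : 0 <= E0.
  by apply: le_trans (coercive 0); rewrite mulr_ge0 ?dotv_ge0 ?divr_ge0// ltW.
split=> //.
pose Y' s := - (m *: grad f (Y s)) - n *: (Y s - V s).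
have dy (s : R) : 0 <= s -> is_derive s 1 y (Y' s).
  move=> s0; have := is_deriveB (dY s s0) (is_derive_cst xstar s 1).
  by rewrite subr0.
(* [8 E0 / a] makes the second term a particular solution of the
   differential inequality for [|y|^2], so that [w' <= - (3 n / 2) w]. *)
pose w s := dotv (y s) (y s) - 8 / a * E0 * expR (- n * s).
pose w' s := dotv (Y' s) (y s) + dotv (y s) (Y' s) -
  8 / a * E0 * (- n * expR (- n * s)).
have wle : w t <= w 0 * expR (- (3 / 2 * n * t)).
  apply: (@exponential_decay _ (3 / 2 * n) w w') => // s s0.
    exact: is_deriveB (is_derive_dotv (dy s s0) (dy s s0))
      (is_deriveZ (8 / a * E0) (is_derive_expR_linear (- n) s)).
  have grd := strongly_convex_gradient mu f (Y s) xstar (ltW mu0) cvx (df _).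
  have gy0 : 0 <= dotv (grad f (Y s)) (y s).
    apply: le_trans grd; rewrite addr_ge0 ?subr_ge0//.
    by rewrite mulr_ge0 ?dotv_ge0 ?divr_ge0// ltW.
  have vle : dotv (v s) (v s) <= 2 / a * E0 * expR (- n * s).
    rewrite -(ler_pM2l (divr_gt0 a0 (ltr0n R 2))) mulNr.
    apply: le_trans (coercive s) (le_trans (decay s s0) _).
    by rewrite le_eqVlt; apply/orP; left; apply/eqP; field; rewrite gt_eqF.
  have YVE : Y s - V s = y s - v s by rewrite /y /v opprB addrA subrK.
  have := dotv_ge0 (y s - 2 *: v s).
  rewrite /w' /w /Y' YVE.
  move: (y s) (v s) (grad f (Y s)) gy0 vle => ys vs g gy0 vle.
  rewrite !dotvE (dotvC ys g) (dotvC vs ys) => sq0.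
  have mgy : 0 <= m * dotv g ys by rewrite mulr_ge0.
  have nsq := mulr_ge0 (ltW n0) sq0.
  move: vle; rewrite -(ler_pM2l n0); lra.
have exle : expR (- (3 / 2 * n * t)) <= expR (- (n * t)).
  rewrite ler_expR lerN2 ler_wpM2r// ler_peMl ?ltW//; lra.
have yle : dotv (y t) (y t) <=
    (dotv (y 0) (y 0) + 8 / a * E0) * expR (- (n * t)).
  have e0 : 0 <= 8 / a * E0 * expR (- (3 / 2 * n * t)).
    by rewrite !mulr_ge0 ?expR_ge0 ?invr_ge0 ?(ltW a0).
  have := ler_wpM2l (dotv_ge0 (y 0)) exle.
  by move: wle; rewrite /w mulr0 expR0 mulNr; lra.
have v0 : 0 <= a / 2 * dotv (v t) (v t).
  by rewrite mulr_ge0 ?dotv_ge0 ?divr_ge0// ltW.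
have := decay t t0; rewrite /E => {}decay.
have a4 : 0 <= a / 4 by rewrite divr_ge0 ?ltW.
have := ler_wpM2l a4 yle.
have -> : a / 4 * ((dotv (y 0) (y 0) + 8 / a * E0) * expR (- (n * t))) =
    (a / 4 * dotv (y 0) (y 0) + 2 * E0) * expR (- (n * t)).
  by field; rewrite gt_eqF.
by rewrite -/a -/(y 0); lra.
Qed.

(** * Parameters of the triple momentum method *)

(** With [D = 2 - rho + rho^2] one finds [s = (1 - rho) (2 + rho) / D], and the
    difference of the two sides factors as
    [(4 / 9) (1 - rho)^3 / D^2] times a polynomial in [rho] which is positive
    for [0 <= rho < 1].  As both sides are of order [(1 - rho)^2], the factor
    [(1 - rho)^3] shows that the bound becomes sharp as [rho] tends to [1]. *)
Lemma triple_momentum_coupling_bound {R : realType} (rho beta gamma s : R) :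
  0 <= rho -> rho < 1 ->
  beta = rho ^+ 2 / (2 - rho) ->
  gamma = rho ^+ 2 / ((1 + rho) * (2 - rho)) ->
  s = (1 - beta) / (1 + beta) ->
  8 / 9 * s ^+ 2 <=
    (1 + rho) * (1 - rho) ^+ 2 * ((1 - 2 / 3 * gamma * s) * (1 + s)).
Proof.
move=> rho0 rho1 betaE gammaE sE.
have D0 : 0 < 2 - rho + rho ^+ 2 by have := sqr_ge0 rho; lra.
have sE' : s = (1 - rho) * (2 + rho) / (2 - rho + rho ^+ 2).
  by rewrite sE betaE; field; rewrite !gt_eqF//; lra.
rewrite -subr_ge0.
set diff := (X in 0 <= X).
have -> : diff = 4 / 9 * (1 - rho) ^+ 3 / (2 - rho + rho ^+ 2) ^+ 2 *
    (10 + 2 * rho - 21 / 2 * rho ^+ 2 + 3 / 2 * rho ^+ 3).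
  by rewrite /diff sE' gammaE; field; rewrite !gt_eqF//; lra.
have rho20 := sqr_ge0 rho.
have rho21 : rho ^+ 2 <= rho by rewrite expr2 ler_piMl// ltW.
have rho30 : 0 <= rho ^+ 3 by rewrite exprn_ge0.
rewrite !mulr_ge0 ?invr_ge0 ?exprn_ge0//; lra.
Qed.

(** In terms of [s = sqrt (M alpha)], the condition [n / p <= 2 mu] reads
    [(16 / 9) s^2 L / (1 + rho) <= 2 L (1 - rho)^2 (1 - xi gamma s) (1 + s)],
    that is, the coupling bound above.  Here [A] is [sqrt alpha] and [sM] is
    [sqrt M]. *)
Lemma triple_momentum_rate_bound {R : realType}
    (mu L rho beta gamma A sM : R) :
  0 < L -> 0 <= rho -> rho < 1 -> mu = L * (1 - rho) ^+ 2 ->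
  beta = rho ^+ 2 / (2 - rho) ->
  gamma = rho ^+ 2 / ((1 + rho) * (2 - rho)) ->
  0 < A -> A ^+ 2 = (1 + rho) / L -> 0 < sM ->
  sM * A = (1 - beta) / (1 + beta) ->
  let n := (2 - 2 / 3) * sM in
  let p := (1 - 2 / 3 * gamma * (sM * A)) * (1 + sM * A) / n in
  0 < p /\ n / p <= 2 * mu.
Proof.
move=> L0 rho0 rho1 muE betaE gammaE A0 A2 sM0 sE n p.
have := triple_momentum_coupling_bound _ _ _ _ rho0 rho1 betaE gammaE sE.
set P := (1 - _ * _ * _) * _ => bound.
have n0 : 0 < n by rewrite /n mulr_gt0//; lra.
have c0 : 0 < (1 + rho) * (1 - rho) ^+ 2.
  by rewrite mulr_gt0 ?exprn_gt0//; lra.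
have P0 : 0 < P.
  rewrite -(pmulr_rgt0 _ c0); apply: lt_le_trans bound.
  by rewrite mulr_gt0 ?exprn_gt0 ?mulr_gt0.
split; first by rewrite /p divr_gt0.
have -> : n / p = n ^+ 2 / P by rewrite /p -/P; field; rewrite !gt_eqF.
have L1 : 0 < L / (1 + rho) by rewrite divr_gt0//; lra.
have sM2 : sM ^+ 2 = (sM * A) ^+ 2 * (L / (1 + rho)).
  by rewrite exprMn A2; field; rewrite !gt_eqF//; lra.
rewrite ler_pdivrMr// /n exprMn sM2 muE.
move: bound; rewrite -(ler_pM2r L1).
have -> : (1 + rho) * (1 - rho) ^+ 2 * P * (L / (1 + rho)) =
    L * (1 - rho) ^+ 2 * P by field; rewrite gt_eqF//; lra.
lra.
Qed.

Theorem corollary2 (R : realType) (d : nat) (mu L : R) (f : 'rV[R]_d -> R)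
  (xstar : 'rV[R]_d)
  (hmu : 0 < mu) (hmuL : mu <= L)
  (hf : class_F mu L f)
  (hxstar : forall x : 'rV[R]_d, f xstar <= f x) :
  let kappa := L / mu in
  let rho := 1 - Num.sqrt (1 / kappa) in
  let alpha := (1 + rho) / L in
  let beta := rho ^+ 2 / (2 - rho) in
  let gamma := rho ^+ 2 / ((1 + rho) * (2 - rho)) in
  let M := ((1 - beta) / (Num.sqrt alpha * (1 + beta))) ^+ 2 in
  let xi : R := 2 / 3 in
  let q := xi * Num.sqrt M in
  let m := gamma * Num.sqrt alpha * (1 + Num.sqrt (M * alpha)) in
  let n := (2 - xi) * Num.sqrt M in
  let p := (1 - xi * gamma * Num.sqrt (M * alpha)) *
           (1 + Num.sqrt (M * alpha)) / ((2 - xi) * Num.sqrt M) in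
  (twice_cont_diff f ->
   forall Y : R -> 'rV[R]_d,
     (exists V : R -> 'rV[R]_d, system_trajectory f m n p q Y V) <->
     ode_solution f
       (2 * Num.sqrt M)
       (gamma * (1 + Num.sqrt (M * alpha)) * Num.sqrt alpha)
       (1 + Num.sqrt (M * alpha)) Y)
  /\
  (forall y0 v0 : 'rV[R]_d,
   exists C_TM : R, 0 < C_TM /\
     forall Y V : R -> 'rV[R]_d,
       system_trajectory f m n p q Y V -> Y 0 = y0 -> V 0 = v0 ->
       forall t : R, 0 <= t ->
         f (Y t) - f xstar <= C_TM * expR (- ((2 - xi) * Num.sqrt M * t))).
Proof.
move=> kappa rho alpha beta gamma M xi q m n p.
have L0 : 0 < L by exact: lt_le_trans hmuL.
have k2 : Num.sqrt (1 / kappa) ^+ 2 = mu / L.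
  by rewrite sqr_sqrtr /kappa div1r invf_div// divr_ge0// ltW.
have k0 : 0 < Num.sqrt (1 / kappa) by rewrite sqrtr_gt0 !divr_gt0.
have k1 : Num.sqrt (1 / kappa) <= 1.
  by rewrite -(@expr_le1 _ 2)// ?(ltW k0)// k2 ler_pdivrMr// mul1r.
have rho0 : 0 <= rho by rewrite subr_ge0.
have rho1 : rho < 1 by rewrite ltrBlDr ltrDl.
have muE : mu = L * (1 - rho) ^+ 2.
  by rewrite /rho subKr k2 mulrC divfK// gt_eqF.
have rho20 : 0 <= rho ^+ 2 by rewrite exprn_ge0.
have alpha0 : 0 < alpha by rewrite divr_gt0//; lra.
have A0 : 0 < Num.sqrt alpha by rewrite sqrtr_gt0.
have A2 : Num.sqrt alpha ^+ 2 = (1 + rho) / L by rewrite sqr_sqrtr// ltW.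
have beta0 : 0 <= beta by rewrite divr_ge0//; lra.
have beta1 : beta < 1.
  rewrite ltr_pdivrMr; last lra.
  have : rho ^+ 2 <= rho by rewrite expr2 ler_piMl// ltW.
  by lra.
have gamma0 : 0 <= gamma by rewrite divr_ge0// mulr_ge0//; lra.
have sME : Num.sqrt M = (1 - beta) / (Num.sqrt alpha * (1 + beta)).
  by rewrite sqrtr_sqr ger0_norm// divr_ge0 ?mulr_ge0//; lra.
have sM0 : 0 < Num.sqrt M by rewrite sME divr_gt0 ?mulr_gt0//; lra.
have sE : Num.sqrt (M * alpha) = Num.sqrt M * Num.sqrt alpha.
  by rewrite sqrtrM// sqr_ge0.
have couplE : Num.sqrt M * Num.sqrt alpha = (1 - beta) / (1 + beta).
  by rewrite sME; field; rewrite !gt_eqF//; lra.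
have [p0 rate] := triple_momentum_rate_bound _ _ _ _ _ _ _ L0 rho0 rho1 muE
  (erefl beta) (erefl gamma) A0 A2 sM0 couplE.
rewrite -sE -/xi -/n -/p in p0 rate.
have n0 : 0 < n by rewrite /n mulr_gt0// /xi; lra.
have m0 : 0 <= m.
  apply: mulr_ge0; last by rewrite addr_ge0 ?sqrtr_ge0.
  exact: mulr_ge0 gamma0 (ltW A0).
have qE : q = n / 2 by rewrite /q /n /xi; field.
split=> [[_ dgrad _] Y|y0 v0].
  have aE : 2 * Num.sqrt M = n + q by rewrite /n /q /xi; field.
  have bE : gamma * (1 + Num.sqrt (M * alpha)) * Num.sqrt alpha = m.
    by rewrite /m mulrAC.
  have cE : 1 + Num.sqrt (M * alpha) = n * p + q * m.
    have -> : n * p = (1 - xi * gamma * Num.sqrt (M * alpha)) *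
        (1 + Num.sqrt (M * alpha)) by rewrite mulrC divfK// gt_eqF.
    by rewrite /q /m sE; ring.
  rewrite aE bE cE; apply: system_iff_ode => //.
  by rewrite gt_eqF.
have [cvx [df _]] := hf.
pose a := n / p.
pose y := y0 - xstar; pose v := v0 - xstar.
pose E0 := f y0 - f xstar + a / 2 * dotv v v - a / 4 * dotv y y.
(* [E0] is nonnegative; the maximum makes the constant visibly positive before
   a trajectory is given. *)
exists (3 * Num.max 0 E0 + a / 4 * dotv y y + 1); split.
  have a0 : 0 <= a := ltW (divr_gt0 n0 p0).
  have yy0 := mulr_ge0 (divr_ge0 a0 (ler0n R 4)) (dotv_ge0 y).
  have max0 : 0 <= Num.max 0 E0 by rewrite le_max lexx.
  by lra.
move=> Y V sys Y0 V0 t t0.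
have [Z [ZY dZ]] := has_derive_ge0_extension Y _ (fun t t0 => (sys t t0).1).
have [U [UV dU]] := has_derive_ge0_extension V _ (fun t t0 => (sys t t0).2).
have [] := system_value_decay mu m n p f xstar Z U t
  hmu m0 n0 p0 rate cvx df hxstar _ _ t0.
- by move=> s s0; rewrite ZY// UV//; exact: dZ.
- by move=> s s0; rewrite ZY// UV// -qE; exact: dU.
rewrite !ZY// !UV// Y0 V0 -/a -/y -/v -/E0 => E00 /le_trans; apply.
rewrite max_r// ler_wpM2r ?expR_ge0//; lra.
Qed.
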